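(* Let $\mathcal{R}=\mathcal{Q}\mathcal{K}$ be an RNN with input dimension $d$ and let $A\in\mathbb{R}^{d\times d'}$, $d'\in\mathbb{N}$. Then there exists an RNN $\mathcal{R}'=\mathcal{Q}\mathcal{K}'$ (with the same output mapping $\mathcal{Q}$) such that, for all $x\in\mathbb{R}^{d'}$ and all $t\in\mathbb{N}_0$, $$(\mathcal{R}'\mathcal{D}x)[t]=(\mathcal{R}\mathcal{D}(Ax))[t]\quad\text{and}\quad(\mathcal{K}'\mathcal{D}x)[t]=(\mathcal{K}\mathcal{D}(Ax))[t].$$
   Context: Notation: $\mathbb{N}=\{1,2,\dots\}$, $\mathbb{N}_0=\mathbb{N}\cup\{0\}$; $(\mathbb{R}^d)^{\mathbb{N}_0}$ is the space of sequences in $\mathbb{R}^d$ indexed by $\mathbb{N}_0$; $\rho(x)=\max(0,x)$, applied componentwise. RNN: An RNN with input dimension $p\in\mathbb{N}$, output dimension $q\in\mathbb{N}$ and hidden state size $m\in\mathbb{N}$ is given by weights $A_h\in\mathbb{R}^{m\times m}$, $A_x\in\mathbb{R}^{m\times p}$, $A_o\in\mathbb{R}^{q\times m}$, $b_h\in\mathbb{R}^m$, $b_o\in\mathbb{R}^{q}$. The hidden state operator $\mathcal{K}:(\mathbb{R}^p)^{\mathbb{N}_0}\to(\mathbb{R}^m)^{\mathbb{N}_0}$ maps an input sequence $(x[t])_{t\in\mathbb{N}_0}$ to $(\mathcal{K}x)[t]=h[t]$, where $h[-1]=0$ and $h[t]=\rho(A_hh[t-1]+A_xx[t]+b_h)$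 for $t\in\mathbb{N}_0$. The output mapping is $\mathcal{Q}(h)=A_oh+b_o$. The associated RNN is $\mathcal{R}=\mathcal{Q}\mathcal{K}$, $(\mathcal{R}x)[t]=\mathcal{Q}((\mathcal{K}x)[t])$. The operator $\mathcal{D}:\mathbb{R}^p\to(\mathbb{R}^p)^{\mathbb{N}_0}$ (for any dimension $p$) is defined by $(\mathcal{D}x)[0]=x$ and $(\mathcal{D}x)[t]=0$ for $t\ge1$. *)

(* Defs.v *)
From mathcomp Require Import all_boot all_order all_algebra.
From mathcomp Require Import reals.

Set Implicit Arguments.
Unset Strict Implicit.
Unset Printing Implicit Defensive.

Import Order.TTheory GRing.Theory Num.Theory.
Local Open Scope ring_scope.

Definition relu (R : realType) (n : nat) (v : 'cV[R]_n) : 'cV[R]_n :=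
  map_mx (Num.max 0) v.

(* [rnn R p q m]: input dimension p, output dimension q, hidden state size m.
   The requirement that dimensions be at least 1 is left to the statements
   that use this type. *)
Record rnn (R : realType) (p q m : nat) := RNN {
  weight_h : 'M[R]_(m, m);
  weight_x : 'M[R]_(m, p);
  weight_o : 'M[R]_(q, m);
  bias_h : 'cV[R]_m;
  bias_o : 'cV[R]_q }.

(* The hidden state operator; the [0%N] branch of the match is h[-1] = 0. *)
Fixpoint hidden_op (R : realType) (p q m : nat) (N : rnn R p q m)
    (x : nat -> 'cV[R]_p) (t : nat) : 'cV[R]_m :=
  relu (weight_h N *m (match t with 0%N => 0 | s.+1 => hidden_op N x s end)
        + weight_x N *m x t + bias_h N).

Definition output_map (R : realType) (p q m : nat) (N : rnn R p q m)
    (h : 'cV[R]_m) : 'cV[R]_q :=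
  weight_o N *m h + bias_o N.

Definition rnn_op (R : realType) (p q m : nat) (N : rnn R p q m)
    (x : nat -> 'cV[R]_p) (t : nat) : 'cV[R]_q :=
  output_map N (hidden_op N x t).

Definition impulse (R : realType) (p : nat) (x : 'cV[R]_p) (t : nat) :
    'cV[R]_p :=
  if t is 0%N then x else 0.

(* Main.v *)
Require Import Defs.
From mathcomp Require Import all_boot all_order all_algebra.
From mathcomp Require Import reals.

Set Implicit Arguments.
Unset Strict Implicit.
Unset Printing Implicit Defensive.

Import Order.TTheory GRing.Theory Num.Theory.
Local Open Scope ring_scope.

(** The input enters the recursion only through the product [weight_x N *m x t], so a linear map
    applied to every input can be absorbed into the input weights by associativity. Since [A] sends
    0 to 0, it commutes with [impulse]; hence both networks see the same pre-activations at every
    time step, and induction on time gives equal hidden states. *)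

Definition precompose (R : realType) (p p' q m : nat) (N : rnn R p q m)
    (A : 'M[R]_(p, p')) : rnn R p' q m :=
  RNN (weight_h N) (weight_x N *m A) (weight_o N) (bias_h N) (bias_o N).

Lemma impulse_mulmx (R : realType) (p p' : nat) (A : 'M[R]_(p, p'))
    (x : 'cV[R]_p') (t : nat) :
  impulse (A *m x) t = A *m impulse x t.
Proof. by case: t => [|t] //=; rewrite mulmx0. Qed.

(** Taking [y] as a separate sequence with a pointwise hypothesis lets [impulse_mulmx] be supplied
    directly, without function extensionality. *)
Lemma hidden_op_precompose (R : realType) (p p' q m : nat) (N : rnn R p q m)
    (A : 'M[R]_(p, p')) (x : nat -> 'cV[R]_p') (y : nat -> 'cV[R]_p)
    (yE : forall t, y t = A *m x t) (t : nat) :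
  hidden_op (precompose N A) x t = hidden_op N y t.
Proof. by elim: t => [|t IHt] /=; rewrite ?IHt yE mulmxA. Qed.

Theorem mainTheorem5 (R : realType) (d q m d' : nat)
    (hd : (0 < d)%N) (hq : (0 < q)%N) (hm : (0 < m)%N) (hd' : (0 < d')%N)
    (N : rnn R d q m) (A : 'M[R]_(d, d')) :
  exists N' : rnn R d' q m,
    output_map N' = output_map N /\
    forall (x : 'cV[R]_d') (t : nat),
      rnn_op N' (impulse x) t = rnn_op N (impulse (A *m x)) t /\
      hidden_op N' (impulse x) t = hidden_op N (impulse (A *m x)) t.
Proof.
(* The output maps agree by computation, since [precompose] keeps [weight_o] and [bias_o]. *)
exists (precompose N A); split=> // x t.
have hE := hidden_op_precompose N (impulse_mulmx A x) t.
by rewrite /rnn_op hE.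
Qed.
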